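(* Let $\mathbb{K}$ be a field and let $\Delta$ be a simplicial complex on a finite vertex set. The total Betti number $\beta_1(I_{\Delta^*})$ is pure if and only if $\Delta$ satisfies the following two conditions. (1) The only disconnected links in $\Delta$ are the links of maximal intersections. (2) All maximal intersections in $\Delta$ have the same size.
   Context: A simplicial complex on a finite vertex set $V$ is a set of subsets of $V$ (faces) closed under taking subsets; facets are the inclusion-maximal faces. For $\sigma\in\Delta$, $\mathrm{link}_\Delta\sigma=\{\tau\in\Delta:\sigma\cap\tau=\emptyset,\ \sigma\cup\tau\in\Delta\}$; a link is disconnected if its $0$th reduced homology is nonzero. The Alexander dual is $\Delta^*=\{F\subseteq V:V\setminus F\notin\Delta\}$. Identifying $V$ with $\{1,\dots,n\}$, in the standard graded ring $R=\mathbb{K}[x_1,\dots,x_n]$ the ideal $I_{\Delta^*}=\langle\prod_{i\in\sigma}x_i:\sigma\subseteq V,\ V\setminus\sigma\in\Delta\rangle$ is the Stanley-Reisner ideal of $\Delta^*$, and $\beta_{i,d}(I_{\Delta^*})$ denotes its graded Betti numbers as an $R$-module. The total Betti number $\beta_i$ is called pure if there is at most a single integer $c$ with $\beta_{i,c}\ne0$. A maximal intersection in $\Delta$ is a face (possibly empty) that is an intersection of more than one facet of $\Delta$, and is maximal with this property with respect to inclusion. *)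

(* Defs.v *)
From HB Require Import structures.
From mathcomp Require Import all_boot all_order all_algebra.
From mathcomp Require Import mpoly.

Set Implicit Arguments.
Unset Strict Implicit.
Unset Printing Implicit Defensive.

Import GRing.Theory.
Local Open Scope ring_scope.

(* The vertex set is identified with 'I_n throughout; not every vertex need be
   a face, and the void complex set0 is allowed. *)

Section Complexes.
Variable n : nat.
Implicit Types (D : {set {set 'I_n}}) (s t : {set 'I_n}).

Definition simplicial_complex D : Prop :=
  forall s t, s \in D -> t \subset s -> t \in D.

Definition facets D : {set {set 'I_n}} :=
  [set s | maxset (fun t => t \in D) s].

Definition link D s : {set {set 'I_n}} :=
  [set t in D | (s :&: t == set0) && (s :|: t \in D)].

Definition alexander_dual D : {set {set 'I_n}} :=
  [set F | ~: F \notin D].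

Definition facet_intersection D s : bool :=
  (s \in D) &&
  [exists S : {set {set 'I_n}},
     [&& S \subset facets D, (1 < #|S|)%N & s == \bigcap_(F in S) F]].

Definition maximal_intersection D s : bool :=
  maxset (facet_intersection D) s.

End Complexes.

Section ReducedHomology.
Variables (K : fieldType) (n : nat).
Implicit Types (D : {set {set 'I_n}}) (c z w : {ffun {set 'I_n} -> K}).

(* Chains over the faces with k elements, that is, of dimension k - 1; the
   empty face is included, so the complex is the augmented one. *)
Definition simplicial_chain D k c : Prop :=
  forall s, c s != 0 -> s \in D /\ #|s| = k.

(* The boundary of a face s is the sum over j in s of (-1)^p times s minus j,
   where p is the position of j in s for the usual order on 'I_n. *)
Definition boundary c : {ffun {set 'I_n} -> K} :=
  [ffun t : {set 'I_n} =>
     \sum_(s : {set 'I_n}) \sum_(j in s | s :\ j == t)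
        (-1) ^+ #|[set k in s | (k < j)%N]| * c s].

Definition reduced_homology_nonzero D (i : nat) : Prop :=
  exists z, [/\ simplicial_chain D i.+1 z, boundary z = 0
              & ~ exists2 w, simplicial_chain D i.+2 w & boundary w = z].

Definition disconnected D : Prop := reduced_homology_nonzero D 0.

End ReducedHomology.

Section Betti.
Variables (K : fieldType) (n : nat).
Local Notation R := {mpoly K[n]}.

Definition stanley_reisner_ideal (D : {set {set 'I_n}}) (f : R) : Prop :=
  exists c : {set 'I_n} -> R,
    f = \sum_(s : {set 'I_n} | s \notin D) c s * \prod_(i in s) 'X_i.

(* The free module F_i is the direct sum of the R(- gfr_deg j), j < gfr_rank i,
   seen as row vectors; the maps act by right multiplication. *)
Record graded_free_data := GradedFreeData {
  gfr_rank : nat -> nat;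
  gfr_deg : forall i, 'I_(gfr_rank i) -> nat;
  gfr_diff : forall i, 'M[R]_(gfr_rank i.+1, gfr_rank i);
  gfr_aug : 'cV[R]_(gfr_rank 0)
}.

(* Degree-preservation of gfr_diff is stated on monomials: the natural-number
   difference of the two degrees would be truncated. *)
Record minimal_graded_free_resolution (I : R -> Prop) (F : graded_free_data)
  : Prop := MinimalGradedFreeResolution {
  gfr_aug_homog : forall j, gfr_aug F j 0 \is (gfr_deg (i := 0) j).-homog;
  gfr_diff_homog : forall i j k m, m \in msupp (gfr_diff F i j k) ->
    (mdeg m + gfr_deg k)%N = gfr_deg j;
  gfr_aug_image : forall f : R,
    I f <-> exists v : 'rV[R]_(gfr_rank F 0), f = (v *m gfr_aug F) 0 0;
  gfr_exact0 : forall v : 'rV[R]_(gfr_rank F 0),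
    v *m gfr_aug F = 0 <-> exists w, v = w *m gfr_diff F 0;
  gfr_exactS : forall i (v : 'rV[R]_(gfr_rank F i.+1)),
    v *m gfr_diff F i = 0 <-> exists w, v = w *m gfr_diff F i.+1;
  gfr_minimal : forall i j k, (gfr_diff F i j k)@_0%MM = 0
}.

(* beta i d is the number of summands R(-d) of F_i in a minimal graded free
   resolution of I.  Such resolutions exist for every homogeneous I and are
   unique up to isomorphism, so exactly one beta satisfies this. *)
Definition is_graded_betti (I : R -> Prop) (beta : nat -> nat -> nat) : Prop :=
  exists2 F, minimal_graded_free_resolution I F &
    forall i d, beta i d = #|[set j : 'I_(gfr_rank F i) | gfr_deg j == d]|.

End Betti.

Definition pure_total_betti (beta : nat -> nat -> nat) (i : nat) : Prop :=
  forall c d, beta i c <> 0%N -> beta i d <> 0%N -> c = d.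

(* Main.v *)
Require Import Defs.
From Stdlib Require Import Classical_Prop.
From mathcomp Require Import all_boot all_order all_algebra.
From mathcomp Require Import zify mpoly.

(* Minimality identifies the degree-d generators of the first syzygy module of
   I = I_{Delta^*} with the degree-d part of the Koszul homology H_1(x; I),
   whatever basis the resolution uses.  As I is a monomial ideal, that homology
   splits by exponent vectors b, where it is the reduced H_0 of the complex of
   all t with x^(b - t) in I.  This complex is a cone unless b is squarefree,
   and then it is the link of the face V \ supp b.  Hence beta_{1,d}(I) <> 0 iff
   some face with n - d vertices has a disconnected link.
   Combinatorially, the link of a maximal intersection is a disjoint union of at
   least two nonempty simplices, so it is disconnected; conversely a face with
   disconnected link is an intersection of facets, since otherwise its link is
   a cone, and hence it lies in a maximal intersection. *)

Set Implicit Arguments.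
Unset Strict Implicit.
Unset Printing Implicit Defensive.

Import GRing.Theory.
Local Open Scope ring_scope.

(** * Reduced zeroth homology read off from the graph of vertices and edges *)

Section GraphHomology.
Variables (K : fieldType) (n : nat).

(* Antisymmetrizing an arbitrary [g] is what makes the pairing of terms in
   double sums work in characteristic 2, where antisymmetry of [g] itself would
   not force the diagonal to vanish. *)
Definition graph_boundary (E : rel 'I_n) (c : 'I_n -> K) : Prop :=
  exists2 g : 'I_n -> 'I_n -> K, forall i j, g i j != 0 -> E i j
    & forall i, c i = \sum_j (g i j - g j i).

Definition graph_h0_nonzero (V : pred 'I_n) (E : rel 'I_n) : Prop :=
  exists c : 'I_n -> K, [/\ forall i, c i != 0 -> V i, \sum_i c i = 0
                          & ~ graph_boundary E c].

Lemma eq_graph_h0 (V V' : pred 'I_n) (E E' : rel 'I_n) :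
  V =1 V' -> E =2 E' -> graph_h0_nonzero V E -> graph_h0_nonzero V' E'.
Proof.
move=> eV eE [c [Vc c0 nb]]; exists c; split=> // [i /Vc|[g gE cE]].
  by rewrite eV.
by apply: nb; exists g => // i j /gE; rewrite eE.
Qed.

Lemma graph_h0_vertex V E : graph_h0_nonzero V E -> exists i, V i.
Proof.
case=> c [Vc _ nb]; apply: NNPP => nV; apply: nb; exists (fun _ _ => 0).
  by move=> i j; rewrite eqxx.
move=> i; rewrite big1 => [|j _]; last by rewrite subrr.
by apply/eqP/negPn/negP => /Vc Vi; apply: nV; exists i.
Qed.

(** Every coefficient is pushed along its edge to the apex [v]; the balance at [v] itself comes out
    right because the coefficients sum to zero. *)
Lemma graph_h0_cone (V : pred 'I_n) (E : rel 'I_n) v :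
  (forall i, i != v -> V i -> E i v) -> ~ graph_h0_nonzero V E.
Proof.
move=> cone [c [Vc c0 nb]]; apply: nb.
exists (fun i j => if (j == v) && (i != v) then c i else 0) => [i j|i].
  by case: ifP => [/andP[/eqP -> iv] /Vc|_]; [apply: cone | rewrite eqxx].
rewrite sumrB /=; have [->|iv] := eqVneq i v.
  rewrite big1 => [|j _]; last by rewrite andbF.
  move: c0; rewrite (bigD1 v) //= => /eqP; rewrite addr_eq0 => /eqP ->.
  rewrite sub0r; congr (- _); rewrite [RHS](bigD1 v) //= eqxx add0r.
  by apply: eq_bigr => j ->.
rewrite (bigD1 v) //= eqxx big1 ?big1 => [|j _|j /negPf ->] //.
by rewrite addr0 subr0.
Qed.

Lemma boundary_set0 (w : {ffun {set 'I_n} -> K}) :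
  boundary w set0 = \sum_i w [set i].
Proof.
rewrite ffunE (exchange_big_dep predT) //=; apply: eq_bigr => i _.
rewrite (big_pred1 [set i]) => [|s /=].
  rewrite (_ : [set _ in _ | _] = set0) ?cards0 ?expr0 ?mul1r //.
  by apply/setP => k; rewrite !inE; have [->|//] := eqVneq k i; rewrite ltnn.
rewrite setD_eq0 subset1; have [->|] := eqVneq s [set i].
  by rewrite set11.
by move=> _; have [->|] := eqVneq s set0; rewrite ?inE // andbF.
Qed.

Lemma boundary_set1 (w : {ffun {set 'I_n} -> K}) i :
  boundary w [set i] = \sum_(j | j != i) (-1) ^+ (i < j)%N * w [set i; j].
Proof.
rewrite ffunE (exchange_big_dep predT) //= [RHS]big_mkcond /=.
apply: eq_bigr => j _; have [->|ji] /= := eqVneq j i.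
  rewrite big_pred0 // => s; apply/negP => /andP[_ /eqP/setP/(_ i)].
  by rewrite !inE eqxx.
rewrite (big_pred1 [set i; j]) => [|s /=].
  congr (_ ^+ _ * _); have [ij|ij] := boolP (i < j)%N.
    rewrite (_ : [set _ in _ | _] = [set i]) ?cards1 //; apply/setP => k.
    rewrite !inE; have [->|ki] := eqVneq k i; first by rewrite ij.
    by have [->|//] := eqVneq k j; rewrite ltnn.
  rewrite (_ : [set _ in _ | _] = set0) ?cards0 //; apply/setP => k.
  rewrite !inE; have [->|ki] := eqVneq k i; first by rewrite (negPf ij).
  by have [->|//] := eqVneq k j; rewrite ltnn.
apply/andP/eqP => [[js /eqP sj]|->].
  by rewrite -(setD1K js) sj setUC.
split; first by rewrite !inE eqxx orbT.
apply/eqP/setP => k; rewrite !inE; have [->|] := eqVneq k j => //=.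
  by rewrite (negPf ji).
by rewrite orbF.
Qed.

Lemma boundary_chain_card k (D : {set {set 'I_n}}) (w : {ffun {set 'I_n} -> K}) t :
  simplicial_chain D k.+1 w -> boundary w t != 0 -> #|t| = k.
Proof.
move=> wk; rewrite ffunE => nz; apply/eqP/negPn/negP => tk; case/negP: nz.
apply/eqP; apply: big1 => s _; apply: big1 => j /andP[js /eqP sj].
have [->|/wk[_ sk]] := eqVneq (w s) 0; first by rewrite mulr0.
by case/negP: tk; move: sk; rewrite (cardsD1 j) js add1n -sj => -[->].
Qed.

(** Reduced H_0 sees only the empty face, vertices and edges, so the signed chains can be traded for
    antisymmetrized functions on pairs of vertices. *)
Lemma disconnected_graph_h0 (L : {set {set 'I_n}}) :
  disconnected K L <->
  graph_h0_nonzero (fun i => [set i] \in L)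
    (fun i j => (i != j) && ([set i; j] \in L)).
Proof.
split.
  case=> z [zL z0 nb]; exists (fun i => z [set i]); split.
  - by move=> i /zL[].
  - by rewrite -boundary_set0 z0 ffunE.
  case=> g gE zE; apply: nb.
  (* The edge with [j < i] gets the value [g i j - g j i]; the sign in [boundary_set1] then produces
     the antisymmetrized sum at either endpoint. *)
  pose w := [ffun s : {set 'I_n} =>
    \sum_(i < n) \sum_(j < n | (j < i)%N && (s == [set i; j])) (g i j - g j i)].
  have wE (i j : 'I_n) : (j < i)%N -> w [set i; j] = g i j - g j i.
    move=> ji; rewrite ffunE (bigD1 i) //= (big_pred1 j) => [|k /=]; last first.
      apply/andP/eqP => [[ki /eqP/setP/(_ k)]|->]; last by rewrite ji eqxx.
      rewrite !inE eqxx orbT orbC; case: eqP => // _ /= /eqP kE.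
      by rewrite kE ltnn in ki.
    rewrite big1 ?addr0 // => i' i'i; rewrite big_pred0 // => k.
    apply/negP => /andP[ki' /eqP eS].
    have: i \in [set i'; k] by rewrite -eS !inE eqxx.
    have: i' \in [set i; j] by rewrite eS !inE eqxx.
    rewrite !inE (negPf i'i) eq_sym (eq_sym i) (negPf i'i) /= => /eqP ji' /eqP ki.
    by move: ki' ji; rewrite ki -ji' => h1 h2; have := ltn_trans h1 h2; rewrite ltnn.
  have gD i j : i != j -> g i j - g j i != 0 -> [set i; j] \in L.
    move=> ij nz; have [gij|/gE/andP[] //] := eqVneq (g i j) 0.
    have [gji|/gE/andP[_]] := eqVneq (g j i) 0; first by rewrite gij gji subr0 eqxx in nz.
    by rewrite setUC.
  have wL : simplicial_chain L 2 w.
    move=> s; rewrite ffunE => nz.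
    have [[i j]/andP[]|no] := pickP [pred p : 'I_n * 'I_n |
      [&& (p.2 < p.1)%N, s == [set p.1; p.2] & g p.1 p.2 - g p.2 p.1 != 0]]; last first.
      case/negP: nz; apply/eqP; apply: big1 => i _; apply: big1 => j /andP[ji sE].
      by have := no (i, j); rewrite /= ji sE /= => /negbFE/eqP.
    rewrite /= => ji /andP[/eqP -> nz'].
    have ij : i != j by apply: contraTneq ji => ->; rewrite ltnn.
    by rewrite cards2 ij; split=> //; apply: gD.
  exists w => //; apply/ffunP => s.
  have [s1|s1] := eqVneq #|s| 1%N; last first.
    have -> : z s = 0 by apply: contra_neq_eq s1 => /zL[].
    by apply: contra_neq_eq s1 => /(boundary_chain_card wL).
  have /cards1P[i ->] : #|s| == 1%N by apply/eqP.
  rewrite boundary_set1 zE [RHS](bigD1 i) //= subrr add0r.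
  apply: eq_bigr => j ji; have [ij|] := boolP (i < j)%N.
    by rewrite setUC wE // expr1 mulN1r opprB.
  rewrite -leqNgt leq_eqVlt => /orP[/eqP/val_inj jE|lt_ji].
    by rewrite jE eqxx in ji.
  by rewrite wE // expr0 mul1r.
case=> c [cV c0 nb].
pose z := [ffun s : {set 'I_n} => \sum_(i | s == [set i]) c i].
have z1 i : z [set i] = c i.
  rewrite ffunE (big_pred1 i) // => j /=.
  by apply/eqP/eqP => [/set1_inj|->].
have zL : simplicial_chain L 1 z.
  move=> s; rewrite ffunE => nz.
  have [i /andP[/eqP -> /cV iL]|no] := pickP [pred i | (s == [set i]) && (c i != 0)].
    by rewrite cards1.
  case/negP: nz; rewrite big1 // => i sE; have := no i.
  by rewrite /= sE /= => /negbFE/eqP.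
exists z; split => //.
  apply/ffunP => s; rewrite [RHS]ffunE.
  have [s0|s0] := eqVneq #|s| 0%N; last first.
    by apply: contra_neq_eq s0 => /(boundary_chain_card zL).
  have -> : s = set0 by apply/eqP; rewrite -cards_eq0 s0.
  by rewrite boundary_set0 -[RHS]c0; apply: eq_bigr => i _.
case=> w wL wz; apply: nb.
(* Only the orientation [j < i] carries a value; the antisymmetrization in [graph_boundary] supplies
   the sign for the other one. *)
exists (fun i j : 'I_n => if (j < i)%N then w [set i; j] else 0) => [i j|i].
  case: ifP => [ji /wL[-> _]|_]; last by rewrite eqxx.
  by rewrite andbT; apply: contraTneq ji => ->; rewrite ltnn.
rewrite -z1 -wz boundary_set1 [RHS](bigD1 i) //= subrr add0r.
apply: eq_bigr => j ji.
case: ltngtP => [ij|ij|/val_inj jE]; last by rewrite jE eqxx in ji.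
  by rewrite expr1 mulN1r sub0r setUC.
by rewrite expr0 mul1r subr0.
Qed.

End GraphHomology.

(** * Disconnected links and intersections of facets *)

Section MaximalIntersections.
Variables (K : fieldType) (n : nat) (D : {set {set 'I_n}}).
Hypothesis hD : simplicial_complex D.
Implicit Types s t : {set 'I_n}.

Lemma mem_link1 s i : ([set i] \in link D s) = (i \notin s) && (i |: s \in D).
Proof.
rewrite inE (setUC s) setI_eq0 disjoint_sym disjoints1.
apply/and3P/andP => [[]|[-> h]]; split=> //.
by apply: hD h _; rewrite subsetUl.
Qed.

Lemma mem_link2 s i j : ([set i; j] \in link D s) =
  [&& i \notin s, j \notin s & i |: (j |: s) \in D].
Proof.
rewrite inE (setUC s) -setUA setI_eq0 disjoint_sym disjoints_subset subUset !sub1set !inE.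
apply/and3P/and3P => [[_ /andP[-> ->]]|[-> -> h]]; split=> //.
by apply: hD h _; rewrite setUA subsetUl.
Qed.

Lemma facet_above s : s \in D -> exists2 F, F \in facets D & s \subset F.
Proof. by case/(@maxset_exists _ (fun t => t \in D)) => F mF sF; exists F; rewrite ?inE. Qed.

Lemma facet_face F : F \in facets D -> F \in D.
Proof. by rewrite inE => /maxsetp. Qed.

Lemma facet_max F t : F \in facets D -> t \in D -> F \subset t -> t = F.
Proof. by rewrite inE => /maxsetP[_]; apply. Qed.

Lemma disconnected_facet_intersection s :
  s \in D -> disconnected K (link D s) -> facet_intersection D s.
Proof.
move=> sD /disconnected_graph_h0 dis.
pose S := [set F in facets D | s \subset F].
have sS : s = \bigcap_(F in S) F.
  apply/eqP; rewrite eqEsubset; apply/andP; split.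
    by apply/bigcapsP => F; rewrite inE => /andP[].
  apply/subsetP => v /bigcapP vS; apply: contraPT dis => vs.
  apply: (@graph_h0_cone _ _ _ _ v) => i iv; rewrite mem_link1 => /andP[is_ isD].
  have [F mF sF] := facet_above isD.
  rewrite iv mem_link2 is_ vs /=; apply: hD (facet_face mF) _.
  move: sF; rewrite !subUset !sub1set => /andP[-> sF]; rewrite sF andbT /=.
  by apply: vS; rewrite inE mF.
rewrite /facet_intersection sD; apply/existsP; exists S; rewrite -sS eqxx andbT.
apply/andP; split; first by apply/subsetP => F; rewrite inE => /andP[].
(* The link has a vertex [i]. If a facet through [i |: s] were the only member of [S], the
   intersection [s] would contain [i]. *)
have [i] := graph_h0_vertex dis; rewrite mem_link1 => /andP[is_ isD].
have [F mF /subsetP sF] := facet_above isD.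
have FS : F \in S.
  by rewrite inE mF; apply/subsetP => x xs; apply: sF; rewrite !inE xs orbT.
rewrite ltnNge; apply/negP => /card_le1_eqP S1; case/negP: is_.
rewrite sS; apply/bigcapP => G GS; rewrite -(S1 _ _ GS FS).
by apply: sF; rewrite !inE eqxx.
Qed.

Lemma maximal_intersection_disconnected s :
  maximal_intersection D s -> disconnected K (link D s).
Proof.
case/maxsetP => /andP[sD /existsP[S /and3P[/subsetP SF S2 /eqP sS]]] smax.
have [F [G [FS GS FG]]] := card_gt1P S2.
have sub H : H \in S -> s \subset H by move=> HS; rewrite sS; apply: bigcap_inf.
have nFG : ~~ (F \subset G).
  by apply: contra FG => /(facet_max (SF _ FS) (facet_face (SF _ GS))) ->.
have nGF : ~~ (G \subset F).
  by apply: contra FG => /(facet_max (SF _ GS) (facet_face (SF _ FS))) ->.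
have [a aF aG] := subsetPn nFG; have [b bG bF] := subsetPn nGF.
(* The cycle is the difference of a vertex of [F] outside [G] and a vertex of [G] outside [F]. *)
apply/disconnected_graph_h0; pose c i : K := (i == a)%:R - (i == b)%:R.
have sum_eq1 (P : pred 'I_n) x : \sum_(i | P i) (i == x)%:R = (P x)%:R :> K.
  have [Px|Px] := boolP (P x).
    by rewrite (bigD1 x) //= eqxx big1 ?addr0 // => i /andP[_ /negPf ->].
  by rewrite big1 // => i Pi; case: eqP Px => // <-; rewrite Pi.
exists c; split.
- move=> i; rewrite mem_link1 /c; have [->|_] := eqVneq i a.
    move=> _; apply/andP; split; first by apply: contra aG; apply/subsetP/sub.
    by apply: hD (facet_face (SF _ FS)) _; rewrite subUset sub1set aF sub.
  have [->|_] := eqVneq i b; last by rewrite subr0 eqxx.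
  move=> _; apply/andP; split; first by apply: contra bF; apply/subsetP/sub.
  by apply: hD (facet_face (SF _ GS)) _; rewrite subUset sub1set bG sub.
- by rewrite sumrB !sum_eq1 subrr.
(* The sum of the coefficients over the facet [F] is 1 for the cycle [c], but 0
   for a boundary, since no edge of the link joins a vertex of [F] to one outside. *)
case=> g gE cE; have /eqP := oner_eq0 K; apply.
have -> : 1 = \sum_(i in F) c i.
  by rewrite sumrB !sum_eq1 aF (negPf bF) subr0.
have gF i j : (i \in F) != (j \in F) -> g i j = 0.
  move=> ij; apply: contraTeq ij => /gE/andP[_].
  rewrite mem_link2 negbK => /and3P[is_ js ijD].
  have [H mH sH] := facet_above ijD.
  have sHs : s \subset H.
    by apply: subset_trans sH; rewrite setUA subsetUr.
  have [iH jH] : i \in H /\ j \in H.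
    by split; apply: (subsetP sH); rewrite !inE eqxx ?orbT.
  have [<-|HF] := eqVneq H F; first by rewrite iH jH.
  (* [H :&: F] is a facet intersection containing [s], hence equal to [s] by maximality; both
     endpoints lie in [H] but not in [s], so neither lies in [F]. *)
  have HFs : H :&: F = s.
    apply: smax; last by rewrite subsetI sHs sub.
    apply/andP; split; first by apply: hD (facet_face mH) _; rewrite subsetIl.
    apply/existsP; exists [set H; F]; rewrite cards2 HF bigcap_setU !big_set1 eqxx.
    by rewrite subUset !sub1set mH SF.
  have notF k : k \notin s -> k \in H -> k \in F = false.
    by move=> ks kH; apply: contraNF ks => kF; rewrite -HFs inE kH.
  by rewrite !notF.
under eq_bigr do rewrite cE sumrB.
have inF (h : 'I_n -> 'I_n -> K) :
    (forall i j, (i \in F) != (j \in F) -> h i j = 0) ->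
    \sum_(i in F) \sum_j h i j = \sum_(i in F) \sum_(j in F) h i j.
  move=> h0; apply: eq_bigr => i iF; rewrite [RHS]big_mkcond; apply: eq_bigr => j _.
  by case: ifP => // jF; rewrite h0 // iF jF.
rewrite sumrB (inF g gF) (inF (fun i j => g j i)) => [|i j ij].
  by rewrite [X in _ - X]exchange_big subrr.
by rewrite gF // eq_sym.
Qed.

End MaximalIntersections.

(** * Monomial supports, graded parts and the ideal of the dual complex *)

Section Polynomials.
Variables (K : fieldType) (n : nat).
Local Notation R := {mpoly K[n]}.
Implicit Types (p q : R) (m b : 'X_{1..n}).

Lemma mcoeffXM m0 p m :
  ('X_[m0] * p)@_m = if (m0 <= m)%MM then p@_(m - m0)%MM else 0.
Proof.
rewrite mulrC; case: ifP => [le|nle]; first by rewrite -[in LHS](submK le) addmC mcoeffMX.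
apply/eqP; rewrite mcoeff_eq0 (perm_mem (msuppMX _ _)).
by apply: contraFN nle => /mapP[m' _ ->]; apply: lem_addr.
Qed.

Lemma mcoeff_filter (P : pred 'X_{1..n}) p m :
  (\sum_(m' <- msupp p | P m') p@_m' *: 'X_[m'])@_m = if P m then p@_m else 0.
Proof.
rewrite raddf_sum /= big_mkcond /=.
have E m' : (if P m' then (p@_m' *: 'X_[m'])@_m else 0) =
            (if (m' == m) && P m then p@_m else 0).
  rewrite mcoeffZ mcoeffX; have [->|_] /= := eqVneq m' m; first by rewrite mulr1.
  by rewrite mulr0; case: ifP.
under eq_bigr do rewrite E; have [mp|mp] := boolP (m \in msupp p).
  rewrite (bigD1_seq m) //= eqxx big1 ?addr0 //.
  by move=> m' /negPf ->.
rewrite big_seq big1 => [|m' m'p]; first by rewrite memN_msupp_eq0 // if_same.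
by case: eqP mp => // <-; rewrite m'p.
Qed.

Lemma msupp_linear_sum (I : Type) (r : seq I) (P : pred I) (F : I -> R) m :
  m \in msupp (\sum_(i <- r | P i) F i) -> exists i, P i /\ m \in msupp (F i).
Proof.
move=> ms; apply: NNPP => no; move: ms; rewrite mcoeff_msupp raddf_sum /= big1 ?eqxx //.
move=> i Pi; apply/eqP; rewrite mcoeff_eq0; apply/negP => mF; apply: no.
by exists i.
Qed.

Lemma mpoly_var_decomposition p : p@_0%MM = 0 ->
  exists2 v : 'I_n -> R, p = \sum_i 'X_i * v i
    & forall i m, m \in msupp (v i) -> (m + U_(i))%MM \in msupp p.
Proof.
(* Each monomial is charged to one chosen variable dividing it, so nothing cancels; [None] occurs
   only for the constant monomial, which [p0] excludes. *)
move=> p0; pose first m := [pick i | m i != 0%N].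
exists (fun i => \sum_(m <- msupp p | first m == Some i) p@_m *: 'X_[m - U_(i)]).
  rewrite {1}[p]mpolyE; under [RHS]eq_bigr do rewrite mulr_sumr.
  rewrite (exchange_big_dep predT) //=; apply: eq_big_seq => m mp.
  rewrite {1}/first; case: pickP => [i mi|m0]; last first.
    have m0' : m = 0%MM by apply/mnmP => i; rewrite mnm0E; apply/eqP/negbFE/m0.
    by move: mp; rewrite m0' mcoeff_msupp p0 eqxx.
  rewrite (big_pred1 i) => [|j]; last by rewrite eq_sym.
  by rewrite -scalerAr -mpolyXD addmC submK // lep1mP.
move=> i m; rewrite big_seq_cond => /msupp_linear_sum[m' [/andP[m'p fm']]].
move/msuppZ_le; rewrite msuppX inE => /eqP ->; rewrite submK // lep1mP.
by move: fm'; rewrite /first; case: pickP => // j mj /eqP[<-].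
Qed.

(* The part of total degree [k] when the generator of the free module carrying
   the coefficient [p] sits in degree [a]; zero if [k < a]. *)
Definition hpart (a k : nat) p : R :=
  \sum_(m <- msupp p | (mdeg m + a == k)%N) p@_m *: 'X_[m].

Lemma mcoeff_hpart a k p m :
  (hpart a k p)@_m = if (mdeg m + a == k)%N then p@_m else 0.
Proof. exact: mcoeff_filter. Qed.

Lemma hpartD a k p q : hpart a k (p + q) = hpart a k p + hpart a k q.
Proof.
by apply/mpolyP => m; rewrite mcoeffD !mcoeff_hpart mcoeffD; case: ifP; rewrite ?addr0.
Qed.

Lemma hpart0 a k : hpart a k 0 = 0.
Proof. by apply/mpolyP => m; rewrite mcoeff_hpart mcoeff0 if_same. Qed.

Lemma hpart_sum a k (I : Type) (r : seq I) (P : pred I) (F : I -> R) :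
  hpart a k (\sum_(i <- r | P i) F i) = \sum_(i <- r | P i) hpart a k (F i).
Proof. exact: (big_morph _ (hpartD a k) (hpart0 a k)). Qed.

Lemma hpart_id a k p :
  {in msupp p, forall m, (mdeg m + a)%N = k} -> hpart a k p = p.
Proof.
move=> h; apply/mpolyP => m; rewrite mcoeff_hpart; case: eqP => // nk.
by apply/esym/eqP; rewrite mcoeff_eq0; apply/negP => /h.
Qed.

(** Here [q] is a matrix entry from a generator of degree [a] to one of degree [c]. Such an entry is
    homogeneous of degree [a - c], so a graded map commutes with taking parts of degree [k]. *)
Lemma hpartM a c k p q : {in msupp q, forall m, (mdeg m + c)%N = a} ->
  hpart c k (p * q) = hpart a k p * q.
Proof.
move=> hq; rewrite -[in LHS](subrK (hpart a k p) p) mulrDl hpartD addrC.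
rewrite [hpart c k (hpart a k p * q)]hpart_id => [|m /msuppM_le].
  rewrite [X in _ + X = _](_ : _ = 0) ?addr0 //; apply/mpolyP => m.
  rewrite mcoeff_hpart mcoeff0; case: ifP => // /eqP mk; apply/eqP.
  rewrite mcoeff_eq0; apply/negP => /msuppM_le/allpairsP[[m1 m2] /= [m1p m2q mE]].
  move: m1p; rewrite mcoeff_msupp mcoeffB mcoeff_hpart -{1}(hq _ m2q) addnA -mdegD.
  by rewrite -mE mk eqxx subrr eqxx.
case/allpairsP => [[m1 m2] /= [m1p m2q ->]].
move: m1p; rewrite mcoeff_msupp mcoeff_hpart.
by case: ifP => [/eqP <- _|_]; [rewrite mdegD -addnA (hq _ m2q) | rewrite eqxx].
Qed.

Lemma hpartXM a k i p : hpart a k.+1 ('X_i * p) = 'X_i * hpart a.+1 k.+1 p.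
Proof.
rewrite mulrC (@hpartM a.+1) 1?mulrC // => m.
by rewrite msuppX inE => /eqP ->; rewrite mdeg1.
Qed.

Lemma hpartS a k p : hpart a.+1 k.+1 p = hpart a k p.
Proof. by apply/mpolyP => m; rewrite !mcoeff_hpart addnS eqSS. Qed.

(** A monomial is a multiple of some generator exactly when it is a multiple of the product over its
    own support, since [D] is closed under subsets. *)
Lemma mem_stanley_reisner_dual (D : {set {set 'I_n}}) p :
  simplicial_complex D ->
  stanley_reisner_ideal (alexander_dual D) p <->
  {in msupp p, forall m, [set i | m i == 0%N] \in D}.
Proof.
move=> hD; have prodX (s : {set 'I_n}) :
    \prod_(i in s) 'X_i = 'X_[\sum_(i in s) U_(i)] :> R.
  by rewrite mprodXE.
have sumU (s : {set 'I_n}) i : (\sum_(j in s) U_(j))%MM i = (i \in s) :> nat.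
  rewrite mnm_sumE; under eq_bigr do rewrite mnm1E.
  have [si|si] := boolP (i \in s).
    by rewrite (bigD1 i) //= eqxx big1 ?addn0 // => j /andP[_ /negPf ->].
  by rewrite big1 // => j js; case: eqP si => // <-; rewrite js.
split=> [[c ->] m|pD].
  move/msupp_linear_sum => [s []]; rewrite inE negbK => sD.
  rewrite prodX mulrC mcoeff_msupp mcoeffXM;
    case: ifP => [/mnm_lepP le _|_]; last by rewrite eqxx.
  apply: hD sD _; apply/subsetP => i; rewrite !inE => /eqP mi.
  by have := le i; rewrite sumU mi leqn0 eqb0.
pose supp m := ~: [set i | m i == 0%N].
exists (fun s => \sum_(m <- msupp p | supp m == s) p@_m *: 'X_[m - \sum_(i in s) U_(i)]).
rewrite {1}[p]mpolyE; under [RHS]eq_bigr do rewrite mulr_suml.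
rewrite (exchange_big_dep predT) //=; apply: eq_big_seq => m mp.
rewrite (big_pred1 (supp m)) => [|s /=].
  rewrite prodX -scalerAl -mpolyXD submK //; apply/mnm_lepP => i.
  by rewrite sumU !inE; case: (m i).
rewrite eq_sym; have [->|] := eqVneq s (supp m); last by rewrite andbF.
by rewrite andbT inE negbK setCK pD.
Qed.

End Polynomials.

(** * Koszul homology of a monomial ideal, one multidegree at a time *)

Section Koszul.
Variables (K : fieldType) (n : nat).
Local Notation R := {mpoly K[n]}.
Implicit Types (M : pred 'X_{1..n}) (m b : 'X_{1..n}) (f : 'I_n -> R).

(* [koszul_vertex] and [koszul_edge] form the 1-skeleton of the complex of all
   squarefree t with x^(b - t) in the ideal spanned by the monomials in [M]. *)
Definition koszul_vertex M b : pred 'I_n :=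
  fun i => (U_(i) <= b)%MM && M (b - U_(i))%MM.

Definition koszul_edge M b : rel 'I_n :=
  fun i j => [&& i != j, (U_(i) + U_(j) <= b)%MM & M (b - (U_(i) + U_(j)))%MM].

Definition koszul_h0 M b : Prop :=
  graph_h0_nonzero K (koszul_vertex M b) (koszul_edge M b).

(** The image of a 2-chain of the Koszul complex with coefficients in the span of [M]; the 2-chain
    is an antisymmetrized [h], as in [graph_boundary]. *)
Definition koszul_boundary M f : Prop :=
  exists2 h : 'I_n -> 'I_n -> R, forall i j, {in msupp (h i j), forall m, M m}
    & forall i, f i = \sum_j 'X_j * (h i j - h j i).

Lemma eq_koszul_boundary M f f' : f =1 f' -> koszul_boundary M f -> koszul_boundary M f'.
Proof. by move=> ff' [h hM hf]; exists h => // i; rewrite -ff'. Qed.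

Lemma koszul_boundary_sum M (I : eqType) (r : seq I) (F : I -> 'I_n -> R) :
  {in r, forall x, koszul_boundary M (F x)} ->
  koszul_boundary M (fun i => \sum_(x <- r) F x i).
Proof.
elim: r => [|x r IH] hF.
  exists (fun _ _ => 0) => [i j m|i]; first by rewrite msupp0.
  by rewrite big_nil big1 // => j _; rewrite subrr mulr0.
have [h hM hf] := hF x (mem_head _ _).
have [|h' hM' hf'] := IH; first by move=> y yr; apply: hF; rewrite inE yr orbT.
exists (fun i j => h i j + h' i j) => [i j m /msuppD_le|i].
  by rewrite mem_cat => /orP[/hM|/hM'].
rewrite big_cons hf hf' -big_split /=; apply: eq_bigr => j _.
by rewrite -mulrDr opprD addrACA.
Qed.

(** The component of [f] in multidegree [b], the [i]-th basis vector having multidegree [U_(i)]. The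
    guard is there because subtraction of exponents truncates. *)
Definition koszul_coef f b i : K := if (U_(i) <= b)%MM then (f i)@_(b - U_(i)) else 0.

Lemma koszul_coef_sum f b : \sum_i 'X_i * f i = 0 -> \sum_i koszul_coef f b i = 0.
Proof.
move=> f0; have := congr1 (mcoeff b) f0; rewrite mcoeff0 raddf_sum /= => {2}<-.
by apply: eq_bigr => i _; rewrite mcoeffXM.
Qed.

Lemma koszul_boundary_monomial M (c : 'I_n -> K) b :
  graph_boundary (koszul_edge M b) c ->
  koszul_boundary M (fun i => c i *: 'X_[b - U_(i)]).
Proof.
case=> g gE cE; exists (fun i j => g i j *: 'X_[b - (U_(i) + U_(j))]).
  move=> i j m; have [->|/gE /and3P[_ _ Mb]] := eqVneq (g i j) 0.
    by rewrite scale0r msupp0.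
  by move/msuppZ_le; rewrite msuppX inE => /eqP ->.
move=> i; rewrite cE scaler_suml; apply: eq_bigr => j _.
rewrite (addmC U_(j)%MM) -scalerBl -scalerAr.
have [gij|] := eqVneq (g i j) 0; last first.
  case/gE/and3P=> _ le _; rewrite -mpolyXD; congr (_ *: 'X_[_]); apply/mnmP => k.
  by have := mnm_lepP le k; rewrite !mnmE; lia.
rewrite gij sub0r !scaleNr; congr (- _).
have [->|] := eqVneq (g j i) 0; first by rewrite !scale0r.
case/gE/and3P=> _ le _; rewrite -mpolyXD; congr (_ *: 'X_[_]); apply/mnmP => k.
by have := mnm_lepP le k; rewrite !mnmE; lia.
Qed.

(** The cycle splits into its multidegree components, each a cycle of the graph in that multidegree;
    these bound by assumption, and the bounding chains add up. *)
Lemma koszul_exact M f :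
  (forall i, {in msupp (f i), forall m, M m}) -> \sum_i 'X_i * f i = 0 ->
  (forall i, {in msupp (f i), forall m, ~ koszul_h0 M (m + U_(i))%MM}) ->
  koszul_boundary M f.
Proof.
move=> fM f0 nh.
(* The finite list of multidegrees that occur in [f]. *)
pose S := undup (flatten [seq [seq (m + U_(i))%MM | m <- msupp (f i)] | i <- enum 'I_n]).
have memS b : b \in S -> exists i m, m \in msupp (f i) /\ b = (m + U_(i))%MM.
  by rewrite mem_undup => /flatten_mapP[i _ /mapP[m mf ->]]; exists i, m.
apply: (@eq_koszul_boundary _ (fun i => \sum_(b <- S) koszul_coef f b i *: 'X_[b - U_(i)])).
  move=> i; apply/mpolyP => m; rewrite raddf_sum /=.
  have E b : (koszul_coef f b i *: 'X_[b - U_(i)])@_m =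
      if b == (m + U_(i))%MM then (f i)@_m else 0.
    rewrite mcoeffZ mcoeffX /koszul_coef; have [->|bm] := eqVneq b (m + U_(i))%MM.
      by rewrite lem_addl addmK eqxx mulr1.
    case: ifP => [le|_]; last by rewrite mul0r.
    case: eqP => [bE|_]; last by rewrite mulr0.
    by rewrite -bE submK ?eqxx in bm.
  under eq_bigr do rewrite E; rewrite -big_mkcond /=.
  have [mS|mS] := boolP ((m + U_(i))%MM \in S).
    by rewrite -big_filter filter_pred1_uniq ?undup_uniq // big_seq1.
  rewrite big_seq_cond big1 => [|b /andP[bS /eqP bE]]; last by rewrite -bE bS in mS.
  apply/esym/eqP; rewrite mcoeff_eq0; apply: contra mS => mf; rewrite mem_undup.
  by apply/flatten_mapP; exists i; rewrite ?mem_enum //; apply: map_f.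
apply: koszul_boundary_sum => b /memS[i0 [m0 [/nh nhb bE]]].
apply: koszul_boundary_monomial; apply: NNPP => nb; apply: nhb; rewrite -bE.
exists (koszul_coef f b); split=> // [i|]; last exact: koszul_coef_sum.
rewrite /koszul_coef /koszul_vertex; case: ifP => [_ nz|_]; last by rewrite eqxx.
by apply: (fM i); rewrite mcoeff_msupp.
Qed.

(** With all monomials allowed, the graph in a multidegree divisible by ['X_i] is a cone with apex
    [i]. *)
Lemma koszul_exact_ring f : \sum_i 'X_i * f i = 0 ->
  exists h : 'I_n -> 'I_n -> R, forall i, f i = \sum_j 'X_j * (h i j - h j i).
Proof.
move=> f0; have [|||h _ hf] := @koszul_exact predT f => //; last by exists h.
move=> i m _; apply: (@graph_h0_cone _ _ _ _ i) => j ji.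
rewrite /koszul_vertex /koszul_edge ji !andbT => /mnm_lepP le.
apply/mnm_lepP => k; have := le k; rewrite !mnmE.
by case: (eqVneq i k) => [<-|_]; rewrite ?(negPf ji); lia.
Qed.

(** Reading off coefficients in multidegree [b] inverts [koszul_boundary_monomial]; diagonal terms
    may be dropped because they cancel. *)
Lemma koszul_boundary_coef M (c : 'I_n -> K) b :
  (forall i, c i != 0 -> koszul_vertex M b i) ->
  koszul_boundary M (fun i => c i *: 'X_[b - U_(i)]) ->
  graph_boundary (koszul_edge M b) c.
Proof.
move=> cV [h hM hc].
exists (fun i j => if (i != j) && (U_(i) + U_(j) <= b)%MM
                   then (h i j)@_(b - (U_(i) + U_(j))) else 0) => [i j|i].
  case: ifP => [/andP[ij le] nz|_]; last by rewrite eqxx.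
  by rewrite /koszul_edge ij le; apply: (hM i j); rewrite mcoeff_msupp.
have [le|nle] := boolP (U_(i) <= b)%MM; last first.
  have -> : c i = 0.
    by apply/eqP/negPn/negP => /cV/andP[]; rewrite (negPf nle).
  rewrite big1 // => j _; rewrite (addmC U_(j)%MM).
  case: ifP => [/andP[_ le]|_].
    by case/negP: nle; apply: lepm_trans le; apply: lem_addr.
  case: ifP => [/andP[_ le]|_]; last by rewrite subrr.
  by case/negP: nle; apply: lepm_trans le; apply: lem_addr.
have := congr1 (mcoeff (b - U_(i))%MM) (hc i).
rewrite mcoeffZ mcoeffX eqxx mulr1 raddf_sum /= => ->; apply: eq_bigr => j _.
have [->|ij] := eqVneq i j; first by rewrite !subrr mulr0 mcoeff0.
rewrite mcoeffXM mcoeffB (addmC U_(j)%MM) submDA /=.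
have -> : (U_(j) <= b - U_(i))%MM = (U_(i) + U_(j) <= b)%MM.
  apply/mnm_lepP/mnm_lepP => h1 k; have := h1 k; have := mnm_lepP le k;
  rewrite !mnmE; lia.
by case: ifP => //; rewrite subrr.
Qed.

End Koszul.

(** This is the vanishing of the composite of two consecutive Koszul differentials. *)
Lemma antisymmetric_sum_eq0 (S : comNzRingType) (V : lmodType S) n
    (x : 'I_n -> S) (w : 'I_n -> 'I_n -> V) :
  \sum_i x i *: (\sum_j x j *: (w i j - w j i)) = 0.
Proof.
under eq_bigr do rewrite scaler_sumr.
under eq_bigr do under eq_bigr do rewrite scalerA scalerBr.
under eq_bigr do rewrite sumrB; rewrite sumrB [X in X - _]exchange_big /=.
by apply/eqP; rewrite subr_eq0; apply/eqP; do 2!apply: eq_bigr => ? _; rewrite mulrC.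
Qed.

Lemma antisymmetric_sum_mulmx (S : comNzRingType) n r (A : 'cV[S]_r)
    (x : 'I_n -> S) (w : 'I_n -> 'I_n -> 'rV[S]_r) i :
  ((\sum_j x j *: (w i j - w j i)) *m A) 0 0 =
    \sum_j x j * ((w i j *m A) 0 0 - (w j i *m A) 0 0).
Proof.
rewrite mulmx_suml summxE; apply: eq_bigr => j _.
by rewrite -scalemxAl mulmxBl mxE [X in _ * X = _]mxE [X in _ * (_ + X) = _]mxE.
Qed.

(** * First syzygies of a minimal resolution and Koszul homology *)

Section Resolution.
Variables (K : fieldType) (n : nat) (I : {mpoly K[n]} -> Prop).
Variables (M : pred 'X_{1..n}) (F : graded_free_data K n).
Hypothesis resF : minimal_graded_free_resolution I F.
Hypothesis monI : forall f, I f <-> {in msupp f, forall m, M m}.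
Local Notation R := {mpoly K[n]}.
Local Notation aug := (gfr_aug F).
Local Notation diff := (gfr_diff F).

Lemma diff_aug_eq0 (u : 'rV[R]_(gfr_rank F 1)) : u *m diff 0 *m aug = 0.
Proof. by apply/(gfr_exact0 resF); exists u. Qed.

Lemma mx11_eq (S : nmodType) (A B : 'M[S]_1) : A 0 0 = B 0 0 -> A = B.
Proof. by move=> AB; apply/matrixP => i j; rewrite !ord1. Qed.

(** By minimality the row [z] of [g] is a combination of the variables, and its coefficients map
    under [aug] to a Koszul cycle [f] in the ideal. Were [f] a boundary, [z] would be the image of a
    vector without constant terms, against minimality. *)
Lemma koszul_h0_of_generator (g : 'I_(gfr_rank F 1)) :
  exists2 b, mdeg b = gfr_deg g & koszul_h0 K M b.
Proof.
apply: NNPP => no; pose z := row g (diff 0).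
have zE : z = delta_mx 0 g *m diff 0 by rewrite -rowE.
have /fin_all_exists2[v zv vsupp] : forall j, exists2 v : 'I_n -> R,
    z 0 j = \sum_i 'X_i * v i &
    forall i m, m \in msupp (v i) -> (m + U_(i))%MM \in msupp (z 0 j).
  by move=> j; apply: mpoly_var_decomposition; rewrite mxE (gfr_minimal resF).
pose r i := \row_j v j i; pose f i := (r i *m aug) 0 0.
have zr : z = \sum_i 'X_i *: r i.
  by apply/rowP => j; rewrite zv summxE; apply: eq_bigr => i _; rewrite !mxE.
have f0 : \sum_i 'X_i * f i = 0.
  transitivity ((z *m aug) 0 0); last by rewrite zE diff_aug_eq0 mxE.
  rewrite zr mulmx_suml summxE; apply: eq_bigr => i _.
  by rewrite -scalemxAl [RHS]mxE.
have fI i : I (f i) by apply/(gfr_aug_image resF); exists (r i).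
have fdeg i m : m \in msupp (f i) -> mdeg (m + U_(i)) = gfr_deg g.
  rewrite /f mxE => /msupp_linear_sum[j [_ /msuppM_le/allpairsP[[m1 m2] /= [m1v m2a ->]]]].
  rewrite mxE in m1v; have := vsupp _ _ _ m1v; rewrite mxE.
  move/(gfr_diff_homog resF) => <-.
  have <- : mdeg m2 = gfr_deg j.
    by have /dhomogP/(_ _ m2a) := gfr_aug_homog resF j.
  by rewrite !mdegD addnAC.
have [i|i m mf h0|h hM hf] := @koszul_exact _ _ M f _ f0.
- exact/monI.
- by apply: no; exists (m + U_(i))%MM => //; apply: fdeg mf.
have /fin_all_exists[w hw] : forall p : 'I_n * 'I_n,
    exists w : 'rV[R]_(gfr_rank F 0), h p.1 p.2 = (w *m aug) 0 0.
  by move=> p; apply/(gfr_aug_image resF)/monI/hM.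
(* Lifting the 2-chain [h] to [w] corrects [r] to syzygies [y] without changing the sum of the
   ['X_i *: r i]. *)
pose y i := r i - \sum_k 'X_k *: (w (i, k) - w (k, i)).
have /fin_all_exists[u uy] : forall i, exists u : 'rV[R]_(gfr_rank F 1), y i = u *m diff 0.
  move=> i; apply/(gfr_exact0 resF)/mx11_eq; rewrite mulmxBl [LHS]mxE [RHS]mxE.
  rewrite -/(f i) hf [X in _ + X]mxE.
  rewrite (antisymmetric_sum_mulmx _ _ (fun i k => w (i, k))).
  by apply/eqP; rewrite subr_eq0; apply/eqP/eq_bigr => k _; rewrite -!hw.
have zy : z = (\sum_i 'X_i *: u i) *m diff 0.
  rewrite mulmx_suml; under eq_bigr do rewrite -scalemxAl -uy scalerBr.
  by rewrite sumrB (antisymmetric_sum_eq0 _ (fun i k => w (i, k))) subr0 -zr.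
have [w' w'E] : exists w', delta_mx 0 g - \sum_i 'X_i *: u i = w' *m diff 1.
  by apply/(gfr_exactS resF); rewrite mulmxBl -zE -zy subrr.
(* The contradiction sits in the constant term of coordinate [g]: it is 1 in
   [delta_mx 0 g - \sum_i 'X_i *: u i], but 0 in the image of [diff 1]. *)
have cu : ((\sum_i 'X_i *: u i) 0 g)@_0%MM = 0.
  rewrite summxE raddf_sum big1 //= => i _.
  by rewrite mxE mcoeffXM lep1mP mnm0E.
have cw : ((w' *m diff 1) 0 g)@_0%MM = 0.
  rewrite mxE raddf_sum big1 //= => k _.
  by rewrite rmorphM /= (gfr_minimal resF) mulr0.
move: cw; rewrite -w'E [in X in X -> _]mxE [X in (_ + X)@__]mxE mcoeffB cu subr0.
by rewrite mxE !eqxx mcoeff1 eqxx => /eqP; rewrite oner_eq0.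
Qed.

(** A Koszul cycle lifts to a syzygy [z] of degree [mdeg b]. Without generators in that degree, [z]
    comes from a vector with no constant terms, and correcting the lift by it leaves a Koszul cycle
    over the free module, which bounds. *)
Lemma generator_of_koszul_h0 b :
  koszul_h0 K M b -> exists g : 'I_(gfr_rank F 1), gfr_deg g = mdeg b.
Proof.
move=> h0; have [i0 /andP[Ui0 _]] := graph_h0_vertex h0.
have [k bk] : exists k, mdeg b = k.+1.
  exists (mdeg (b - U_(i0))%MM); rewrite -[in LHS](submK Ui0) mdegD mdeg1; lia.
apply: NNPP => no; case: h0 => c [cV c0 nb]; apply: nb; apply: (koszul_boundary_coef cV).
pose f i : R := c i *: 'X_[b - U_(i)].
have Xf i : 'X_i * f i = c i *: 'X_[b].
  have [ci|/cV/andP[le _]] := eqVneq (c i) 0; first by rewrite /f ci !scale0r mulr0.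
  by rewrite -scalerAr -mpolyXD addmC submK.
have fdeg i : hpart 0 k (f i) = f i.
  apply: hpart_id => m; rewrite /f.
  have [->|/cV/andP[le _]] := eqVneq (c i) 0; first by rewrite scale0r msupp0.
  move/msuppZ_le; rewrite msuppX inE => /eqP ->.
  by apply/eqP; rewrite -eqSS -bk -[in X in _ == X](submK le) mdegD mdeg1 addn0 addn1.
have /fin_all_exists[v fv] : forall i, exists v : 'rV[R]_(gfr_rank F 0), f i = (v *m aug) 0 0.
  move=> i; apply/(gfr_aug_image resF)/monI => m; rewrite /f.
  have [->|/cV/andP[_ Mb]] := eqVneq (c i) 0; first by rewrite scale0r msupp0.
  by move/msuppZ_le; rewrite msuppX inE => /eqP ->.
(* Each [f i] is homogeneous of degree [k], so the lift can be cut down to that degree. *)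
pose v' i := \row_j hpart (gfr_deg j) k (v i 0 j).
have fv' i : f i = (v' i *m aug) 0 0.
  rewrite -[LHS]fdeg fv !mxE hpart_sum; apply: eq_bigr => j _.
  rewrite mxE; apply: hpartM => m ma; rewrite addn0.
  by have /dhomogP/(_ _ ma) := gfr_aug_homog resF j.
pose z := \sum_i 'X_i *: v' i.
have [u zu] : exists u, z = u *m diff 0.
  apply/(gfr_exact0 resF)/mx11_eq; rewrite mulmx_suml summxE mxE.
  under eq_bigr do rewrite -scalemxAl mxE -fv' Xf.
  by rewrite -scaler_suml c0 scale0r.
pose u' := \row_l hpart (gfr_deg l) k.+1 (u 0 l).
have zu' : z = u' *m diff 0.
  apply/rowP => j; transitivity (hpart (gfr_deg j) k.+1 (z 0 j)).
    rewrite summxE hpart_sum; apply: eq_bigr => i _; rewrite !mxE hpartXM hpartS.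
    by rewrite [in RHS]hpart_id // => m; rewrite mcoeff_msupp mcoeff_hpart;
      case: ifP => [/eqP|]; rewrite ?eqxx.
  rewrite zu !mxE hpart_sum; apply: eq_bigr => l _; rewrite mxE.
  by apply: hpartM => m /(gfr_diff_homog resF).
have /fin_all_exists[t ut] : forall l, exists t : 'I_n -> R, u' 0 l = \sum_i 'X_i * t i.
  move=> l; have [|t ut _] := @mpoly_var_decomposition _ _ (u' 0 l); last by exists t.
  (* In degree [k.+1] a constant term of coordinate [l] survives only if [gfr_deg l = mdeg b], which
     [no] rules out. *)
  rewrite mxE mcoeff_hpart mdeg0 add0n -bk.
  by case: eqP => // gl; case: no; exists l.
pose s i := \row_l t l i; pose y i := v' i - s i *m diff 0.
have y0 : \sum_i 'X_i *: y i = 0.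
  under eq_bigr do rewrite scalerBr scalemxAl.
  rewrite sumrB -mulmx_suml -/z zu' -mulmxBl [X in X *m _](_ : _ = 0) ?mul0mx //.
  apply/eqP; rewrite subr_eq0; apply/eqP/rowP => l; rewrite ut summxE.
  by apply: eq_bigr => i _; rewrite !mxE.
have /fin_all_exists[h hy] : forall j, exists h : 'I_n -> 'I_n -> R,
    forall i, y i 0 j = \sum_k 'X_k * (h i k - h k i).
  move=> j; apply: koszul_exact_ring.
  transitivity ((\sum_i 'X_i *: y i) 0 j); last by rewrite y0 mxE.
  by rewrite summxE; apply: eq_bigr => i _; rewrite [RHS]mxE.
pose w i k := \row_j h j i k.
exists (fun i j => (w i j *m aug) 0 0) => [i j|i].
  by apply/monI/(gfr_aug_image resF); exists (w i j).
rewrite -/(f i) fv' -[v' i](subrK (s i *m diff 0)) -/(y i) mulmxDl diff_aug_eq0 addr0.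
have -> : y i = \sum_k 'X_k *: (w i k - w k i).
  by apply/rowP => j; rewrite hy summxE; apply: eq_bigr => ? _; rewrite !mxE.
exact: antisymmetric_sum_mulmx.
Qed.

End Resolution.

(** * From Koszul homology in squarefree multidegrees to links of faces *)

Section Links.
Variables (K : fieldType) (n : nat) (D : {set {set 'I_n}}).
Hypothesis hD : simplicial_complex D.
Implicit Types (b : 'X_{1..n}) (s : {set 'I_n}).

Local Notation zeros b := [set i | b i == 0%N].
Local Notation M := (fun m : 'X_{1..n} => zeros m \in D).

(** If [b v] is at least 2, dividing by ['X_v] once leaves the support unchanged, so [v] is the apex
    of a cone. *)
Lemma koszul_h0_squarefree b : koszul_h0 K M b -> forall i, (b i <= 1)%N.
Proof.
move=> h0 v; apply: contraPT h0; rewrite -ltnNge => bv.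
apply: (@graph_h0_cone _ _ _ _ v) => i iv /andP[/mnm_lepP le bD].
have bi : (0 < b i)%N by have := le i; rewrite mnm1E eqxx.
apply/and3P; split=> //.
  apply/mnm_lepP => k; rewrite mnmDE !mnm1E.
  have [<-|_] := eqVneq i k; first by rewrite eq_sym (negPf iv).
  by have [<-|_] := eqVneq v k; lia.
rewrite (_ : [set _ | _] = zeros (b - U_(i))%MM) //.
apply/setP => k; rewrite !inE !mnmE; have [<-|] := eqVneq v k; last by rewrite addn0.
by rewrite (negPf iv); lia.
Qed.

(** For squarefree [b], dividing by a variable in the support adds its index to the zero set, so
    Koszul vertices and edges are those of the link. *)
Lemma koszul_h0_link b : (forall i, (b i <= 1)%N) ->
  koszul_h0 K M b <-> disconnected K (link D (zeros b)).
Proof.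
move=> b1; have eV : koszul_vertex M b =1 (fun i => [set i] \in link D (zeros b)).
  move=> i; rewrite mem_link1 // /koszul_vertex lep1mP inE; congr (_ && (_ \in D)).
  apply/setP => k; rewrite !inE mnmBE mnm1E (eq_sym k); have := b1 k.
  by case: (eqVneq i k) => _ /=; lia.
have eE : koszul_edge M b =2 (fun i j => (i != j) && ([set i; j] \in link D (zeros b))).
  move=> i j; rewrite mem_link2 // /koszul_edge !inE.
  have [//|ij] /= := eqVneq i j; rewrite andbA; congr (_ && (_ \in D)).
    apply/mnm_lepP/andP => [le|[bi bj] k].
      have := le i; have := le j; rewrite !mnmDE !mnm1E !eqxx (negPf ij) eq_sym (negPf ij).
      by lia.
    rewrite mnmDE !mnm1E; have [<-|_] := eqVneq i k.
      by rewrite eq_sym (negPf ij); lia.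
    by have [<-|_] := eqVneq j k; lia.
  apply/setP => k; rewrite !inE mnmBE mnmDE !mnm1E (eq_sym k) (eq_sym k j).
  have := b1 k; by case: (eqVneq i k) => _ /=; case: (eqVneq j k) => _ /=; lia.
split=> [h0|/disconnected_graph_h0 h0].
  by apply/disconnected_graph_h0; apply: eq_graph_h0 h0.
by apply: eq_graph_h0 h0 => [i|i j]; rewrite ?eV ?eE.
Qed.

Lemma disconnected_link_face s : disconnected K (link D s) -> s \in D.
Proof.
move=> /disconnected_graph_h0/graph_h0_vertex[i]; rewrite mem_link1 // => /andP[_ h].
by apply: hD h _; rewrite subsetUr.
Qed.

Lemma mdeg_squarefree b : (forall i, (b i <= 1)%N) -> (mdeg b + #|zeros b|)%N = n.
Proof.
move=> b1; rewrite mdegE -sum1_card [X in (_ + X)%N]big_mkcond -big_split /=.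
rewrite -[RHS]card_ord -sum1_card; apply: eq_bigr => i _; rewrite inE.
by have := b1 i; case: eqP; lia.
Qed.

Lemma betti1_neq0 (F : graded_free_data K n) (d : nat) :
  minimal_graded_free_resolution (stanley_reisner_ideal (alexander_dual D)) F ->
  #|[set j : 'I_(gfr_rank F 1) | gfr_deg j == d]| <> 0%N <->
  exists2 s, disconnected K (link D s) & (d + #|s|)%N = n.
Proof.
move=> resF; have monI (f : {mpoly K[n]}) := mem_stanley_reisner_dual f hD.
split=> [/eqP|[s dis ds]].
  rewrite cards_eq0 => /set0Pn[g]; rewrite inE => /eqP <-.
  have [b <- h0] := koszul_h0_of_generator (M := M) resF monI g.
  have b1 := koszul_h0_squarefree h0.
  by exists (zeros b); [apply/koszul_h0_link | apply: mdeg_squarefree].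
(* The squarefree exponent whose zero set is [s]. *)
pose b : 'X_{1..n} := [multinom (i \notin s : nat) | i < n].
have b1 i : (b i <= 1)%N by rewrite mnmE leq_b1.
have sE : zeros b = s by apply/setP => i; rewrite inE mnmE eqb0 negbK.
have /(generator_of_koszul_h0 (M := M) resF monI)[g gb] : koszul_h0 K M b.
  by apply/koszul_h0_link => //; rewrite sE.
apply/eqP; rewrite cards_eq0; apply/set0Pn; exists g; rewrite inE gb.
by rewrite -(eqn_add2r #|s|) ds -{1}sE mdeg_squarefree.
Qed.

End Links.

(** * Purity as equality of the sizes of all faces with disconnected link *)

Theorem proposition4p54 (K : fieldType) (n : nat) (D : {set {set 'I_n}})
    (hD : simplicial_complex D) (beta : nat -> nat -> nat)
    (hbeta : is_graded_betti (stanley_reisner_ideal (K := K) (alexander_dual D)) beta) :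
  pure_total_betti beta 1 <->
  (forall s : {set 'I_n}, s \in D -> disconnected K (link D s) ->
     maximal_intersection D s) /\
  (forall s t : {set 'I_n}, maximal_intersection D s ->
     maximal_intersection D t -> #|s| = #|t|).
Proof.
have [F resF betaF] := hbeta.
have b1P d : beta 1%N d <> 0%N <->
    exists2 s, disconnected K (link D s) & (d + #|s|)%N = n.
  by rewrite betaF; apply: betti1_neq0.
split=> [pure|[dis_max max_card] c d /b1P[s ds cs] /b1P[t dt dn]]; last first.
  have sD := disconnected_link_face hD ds; have tD := disconnected_link_face hD dt.
  by apply: (@addIn #|s|); rewrite cs (max_card s t) ?dis_max.
have dis_card (s t : {set 'I_n}) : disconnected K (link D s) ->
    disconnected K (link D t) -> #|s| = #|t|.
  (* The bound by [n] keeps the subtractions [n - #|s|] and [n - #|t|] from truncating. *)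
  move=> ds dt; have le (u : {set 'I_n}) : (#|u| <= n)%N.
    by rewrite -[X in (_ <= X)%N]card_ord max_card.
  have := pure (n - #|s|)%N (n - #|t|)%N; have := le s; have := le t.
  suff h (u : {set 'I_n}) : disconnected K (link D u) -> beta 1%N (n - #|u|)%N <> 0%N.
    by move=> lt ls /(_ (h _ ds) (h _ dt)); lia.
  by move=> du; apply/b1P; exists u; rewrite ?subnK.
have max_dis s := @maximal_intersection_disconnected K n D hD s.
split=> [s sD ds|s t /max_dis ds /max_dis dt]; last exact: dis_card.
(* A maximal intersection [t] above [s] also has a disconnected link, so it has the size of [s] and
   equals it. *)
have [t mt st] := maxset_exists (disconnected_facet_intersection hD sD ds).
have -> // : s = t.
by apply/eqP; rewrite eqEcard st (dis_card _ _ (max_dis _ mt) ds) leqnn.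
Qed.
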